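(* Let $n\ge 1$, let $\mathcal{E}$ be a Hilbert space, and let $L\in\mathcal{B}(\mathcal{E},\mathcal{F}^2_n\otimes\mathcal{E})$. Then $(W_L,S^{\mathcal{E}})$ is an isometric Fock representation of $O_n$ if and only if the following conditions hold: (1) $L$ is an isometry; (2) $L\mathcal{E}\subseteq\mathcal{E}_L$, where \[ \mathcal{E}_L=\overline{\mathrm{span}}\{e_1^{\otimes m}\otimes\eta: m\ge 0,\ \eta\in\mathcal{E}\}\ominus\overline{\mathrm{span}}\{e_1^{\otimes p}\otimes L\zeta: p\ge1,\ \zeta\in\mathcal{E}\}. \]
   Context: All Hilbert spaces are complex and separable. $\mathcal{B}(\mathcal{H},\mathcal{K})$ is the space of bounded linear operators from $\mathcal{H}$ to $\mathcal{K}$, and $\mathcal{B}(\mathcal{H})=\mathcal{B}(\mathcal{H},\mathcal{H})$. $F_n^+$ is the free semigroup on letters $g_1,\dots,g_n$ with identity $g_0$. The Fock space is $\mathcal{F}^2_n=\mathbb{C}\Omega\oplus\bigoplus_{k\ge1}(\mathbb{C}^n)^{\otimes k}$ with vacuum unit vector $\Omega$; $\{e_1,\dots,e_n\}$ is the standard orthonormal basis of $\mathbb{C}^n$; $e_\mu=e_{\mu_1}\otimes\cdots\otimes e_{\mu_k}$ for $\mu=g_{\mu_1}\cdots g_{\mu_k}$ and $e_{g_0}=\Omega$; the $e_\mu$ form an orthonormal basis of $\mathcal{F}^2_n$. Also $e_1^{\otimes0}=\Omega$. The creation operators are $S_if=e_i\otimes f$, and $S^{\mathcal{E}}=(S_1\otimes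 I_{\mathcal{E}},\dots,S_n\otimes I_{\mathcal{E}})$. The vector $e_1^{\otimes m}\otimes L\eta$ means $(S_1^m\otimes I_{\mathcal{E}})L\eta$. $A\ominus B$ denotes the set of vectors of $A$ orthogonal to $B$. Odometer map: for $L\in\mathcal{B}(\mathcal{E},\mathcal{F}^2_n\otimes\mathcal{E})$, the odometer map with symbol $L$ is the operator $W_L\in\mathcal{B}(\mathcal{F}^2_n\otimes\mathcal{E})$ defined by $W_L(\Omega\otimes\eta)=L\eta$; $W_L(e_n^{\otimes m}\otimes\eta)=e_1^{\otimes m}\otimes L\eta$ for $m\ge1$; and $W_L(e_n^{\otimes j}\otimes e_i\otimes e_\nu\otimes\eta)=e_1^{\otimes j}\otimes e_{i+1}\otimes e_\nu\otimes\eta$ for $j\ge0$, $1\le i\le n-1$, $\nu\in F_n^+$; here $\eta\in\mathcal{E}$ is arbitrary, and tensor factors equal to $\Omega$ next to other factors are dropped. $(W,T)$ with $T=(T_1,\dots,T_n)$ and $W,T_i\in\mathcal{B}(\mathcal{H})$ is a representation of the odometer semigroup $O_n$ if $WT_i=T_{i+1}$ for $1\le i\le n-1$ and $WT_n=T_1W$. A Fock representation is a representation $(W,S^{\mathcal{E}})$ with $W\in\mathcal{B}(\mathcal{F}^2_n\otimes\mathcal{E})$; it is isometric if $W$ is an isometry. *)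

(* Defs.v *)
From HB Require Import structures.
From mathcomp Require Import all_boot all_order all_algebra.
From mathcomp Require Import complex ring lra.
From mathcomp Require Import boolp classical_sets functions cardinality.
From mathcomp Require Import reals topology normedtype sequences.

Set Implicit Arguments.
Unset Strict Implicit.
Unset Printing Implicit Defensive.

Import Order.TTheory GRing.Theory Num.Theory.
Import numFieldNormedType.Exports.

Local Open Scope classical_set_scope.
Local Open Scope ring_scope.
Local Open Scope complex_scope.

(* A complex Hilbert space: the inner product is linear in its first argument
   and induces the norm, for which the space is complete. Separability is a
   separate predicate, [separable_space]. *)
HB.mixin Record isHilbert (R : realType) H & CompleteNormedModule R[i] H := {
  inner : {dot H for @Num.conj R[i]} ;
  inner_norm : forall x : H, inner x x = `|x| ^+ 2
}.

#[short(type="hilbertType")]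
HB.structure Definition Hilbert (R : realType) :=
  { H of isHilbert R H & CompleteNormedModule R[i] H}.

Section DotNorm.
Variables (C : numClosedFieldType) (U : lmodType C) (form : {dot U for @Num.conj C}).
Local Notation "''[' u , v ]" := (form u v) : ring_scope.
Local Notation "''[' u ]" := (form u u) : ring_scope.

Lemma dot_CauchySchwarz (u v : U) : `|'[u, v]| ^+ 2 <= '[u] * '[v].
Proof.
have [->|nz_v] := eqVneq v 0; first by rewrite !linear0r normr0 expr0n mulr0.
pose a := '[u, v] / '[v]; pose w := u - a *: v.
have ow : '[w, v] = 0.
  by rewrite linearBl linearZl_LR /= divfK ?dnorm_eq0 ?subrr.
have -> : u = w + a *: v by rewrite /w subrK.
rewrite linearDl /= ow add0r linearZl_LR /= normrM (ger0_norm (dnorm_ge0 _ _)).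
rewrite exprMn hnormDd /=; last by rewrite linearZr_LR /= ow mulr0.
rewrite [X in _ <= (_ + X) * _]dnormZ mulrDl expr2 mulrA.
rewrite [X in _ <= _ + X](_ : _ = `|a| * `|a| * '[v] * '[v]) ?expr2 //.
by rewrite lerDr mulr_ge0 ?dnorm_ge0.
Qed.

Lemma dot_sqrtC_triangle (u v : U) :
  sqrtC '[u + v] <= sqrtC '[u] + sqrtC '[v].
Proof.
rewrite -ler_sqr ?nnegrE ?addr_ge0 ?sqrtC_ge0 ?dnorm_ge0 //.
rewrite sqrrD !sqrtCK dnormD [leRHS]addrAC lerD2l.
rewrite -mulr_natr -[leLHS](divfK (negbT (pnatr_eq0 C 2))) -ReE.
rewrite ler_pM2r ?ltr0n // -sqrtCM ?nnegrE ?dnorm_ge0 //.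
apply: le_trans (_ : `|'[u, v]| <= _).
  by have := leif_Re_Creal '[u, v]; case.
rewrite -ler_sqr ?nnegrE ?sqrtC_ge0 ?mulr_ge0 ?dnorm_ge0 //.
by rewrite sqrtCK dot_CauchySchwarz.
Qed.

End DotNorm.

Section SummableFamily.
Variables (I : countType) (R : realType).
Implicit Types u v : I -> R.

(* [pickle_inv] lists every element of [I] exactly once *)
Definition enum_family u : R^nat := fun k => oapp u 0 (pickle_inv k).
Definition summable_family u := cvgn (series (enum_family u)).
Definition family_sum u : R := limn (series (enum_family u)).

Lemma enum_familyD u v : enum_family (u \+ v) = enum_family u + enum_family v.
Proof.
by apply/funext => k; rewrite /enum_family !fctE; case: pickle_inv => //=; rewrite addr0.
Qed.

Lemma enum_familyZ a u : enum_family (fun i => a * u i) = a *: enum_family u.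
Proof.
by apply/funext => k; rewrite /enum_family !fctE; case: pickle_inv => //=; rewrite scaler0.
Qed.

Lemma enum_family_ge0 u k : (forall i, 0 <= u i) -> 0 <= enum_family u k.
Proof. by move=> u0; rewrite /enum_family; case: pickle_inv => /=. Qed.

Lemma summable_familyD u v :
  summable_family u -> summable_family v -> summable_family (u \+ v).
Proof. by rewrite /summable_family enum_familyD; exact: is_cvg_seriesD. Qed.

Lemma summable_familyZ a u :
  summable_family u -> summable_family (fun i => a * u i).
Proof. by rewrite /summable_family enum_familyZ; exact: is_cvg_seriesZ. Qed.

Lemma family_sumD u v : summable_family u -> summable_family v ->
  family_sum (u \+ v) = family_sum u + family_sum v.
Proof. by rewrite /family_sum enum_familyD; exact: lim_seriesD. Qed.

Lemma family_sumZ a u : summable_family u ->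
  family_sum (fun i => a * u i) = a * family_sum u.
Proof. by rewrite /family_sum enum_familyZ; exact: lim_seriesZ. Qed.

Lemma summable_family_le u v : (forall i, `|u i| <= v i) ->
  summable_family v -> summable_family u.
Proof.
move=> uv sv; apply: normed_cvg.
apply: series_le_cvg sv => k.
- by rewrite normr_ge0.
- by apply: enum_family_ge0 => i; apply: le_trans (uv i).
- by rewrite /enum_family /=; case: pickle_inv => [i|] /=; rewrite ?normr0 ?uv.
Qed.

Lemma summable_family0 : summable_family (fun=> 0).
Proof.
rewrite /summable_family (_ : enum_family _ = 0 *: enum_family (fun=> 0)).
  rewrite seriesZ.
  rewrite (_ : 0 *: _ = cst 0); first exact: is_cvg_cst.
  by rewrite scale0r.
by apply/funext => k; rewrite !fctE scale0r /enum_family; case: pickle_inv.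
Qed.

Lemma series_enum_familyE u n :
  series (enum_family u) n = \sum_(i <- pmap (@pickle_inv I) (iota 0 n)) u i.
Proof.
rewrite /series /= /index_iota subn0.
elim: (iota 0 n) => [|k s IH]; first by rewrite !big_nil.
rewrite big_cons IH /= /enum_family; case: pickle_inv => [i|] /=.
  by rewrite big_cons.
by rewrite add0r.
Qed.

Lemma uniq_pmap_pickle_inv n : uniq (pmap (@pickle_inv I) (iota 0 n)).
Proof. exact/(pmap_uniq pickle_invK)/iota_uniq. Qed.

Lemma summable_family_bounded u M : (forall i, 0 <= u i) ->
  (forall s : seq I, uniq s -> \sum_(i <- s) u i <= M) -> summable_family u.
Proof.
move=> u0 uM; apply: nondecreasing_is_cvgn.
  by apply/nondecreasing_seqP => n; rewrite seriesSr lerDl enum_family_ge0.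
exists M => _ [n _ <-]; rewrite series_enum_familyE.
exact/uM/uniq_pmap_pickle_inv.
Qed.

Lemma series_enum_family_le u n : (forall i, 0 <= u i) -> summable_family u ->
  series (enum_family u) n <= family_sum u.
Proof.
move=> u0 su; apply: nondecreasing_cvgn_le => //.
by apply/nondecreasing_seqP => m; rewrite seriesSr lerDl enum_family_ge0.
Qed.

Lemma finite_sum_le_family_sum u (s : seq I) : (forall i, 0 <= u i) ->
  summable_family u -> uniq s -> \sum_(i <- s) u i <= family_sum u.
Proof.
move=> u0 su us; pose n := (\max_(i <- s) (pickle i).+1)%N.
apply: le_trans (series_enum_family_le n u0 su).
rewrite series_enum_familyE.
set t := pmap _ _.
have st : {subset s <= t}.
  move=> i is_; rewrite mem_pmap; apply/mapP; exists (pickle i).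
    by rewrite mem_iota /= add0n; apply: (@leq_bigmax_seq _ s predT (fun j => (pickle j).+1)).
  by rewrite pickleK_inv.
have -> : \sum_(i <- s) u i = \sum_(i <- [seq i <- t | i \in s]) u i.
  apply: perm_big; apply: uniq_perm => //.
    exact/filter_uniq/uniq_pmap_pickle_inv.
  by move=> i; rewrite mem_filter andb_idr //; exact: st.
by rewrite big_filter [leRHS](bigID (mem s)) /= lerDl sumr_ge0.
Qed.

Lemma family_sum_le u M : (forall i, 0 <= u i) ->
  (forall s : seq I, uniq s -> \sum_(i <- s) u i <= M) -> family_sum u <= M.
Proof.
move=> u0 uM; apply: limr_le; first exact: summable_family_bounded uM.
apply: nearW => n; rewrite series_enum_familyE.
exact/uM/uniq_pmap_pickle_inv.
Qed.

Lemma family_sum_ge0 u : (forall i, 0 <= u i) -> summable_family u ->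
  0 <= family_sum u.
Proof.
by move=> u0 su; have := finite_sum_le_family_sum u0 su (erefl (uniq [::])); rewrite big_nil.
Qed.

Lemma family_sum_eq0 u : (forall i, 0 <= u i) -> summable_family u ->
  family_sum u = 0 -> forall i, u i = 0.
Proof.
move=> u0 su s0 i; apply/le_anti; rewrite u0 andbT -s0.
by have := finite_sum_le_family_sum u0 su (erefl (uniq [:: i])); rewrite big_seq1.
Qed.

End SummableFamily.
Arguments summable_familyD : clear implicits.
Arguments summable_familyD {I R u v}.
Arguments summable_familyZ : clear implicits.
Arguments summable_familyZ {I R} a {u}.

Section Ell2.
Variables (R : realType) (I : countType) (E : hilbertType R).
Implicit Types (f g : I -> E) (x y z : E).

Lemma inner_ge0 x : 0 <= inner x x.
Proof. exact: dnorm_ge0. Qed.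

Lemma ReK (c : R[i]) : 0 <= c -> (complex.Re c)%:C = c.
Proof. by move=> c0; rewrite RRe_real ?ger0_real. Qed.

Lemma Re_ge0 (c : R[i]) : 0 <= c -> 0 <= complex.Re c.
Proof. by move=> c0; rewrite -ler0c ReK. Qed.

Lemma ReD (c d : R[i]) : complex.Re (c + d) = complex.Re c + complex.Re d.
Proof. by case: c d => [a b] [a' b']. Qed.

Lemma ImD (c d : R[i]) : complex.Im (c + d) = complex.Im c + complex.Im d.
Proof. by case: c d => [a b] [a' b']. Qed.

Lemma ReN (c : R[i]) : complex.Re (- c) = - complex.Re c.
Proof. by case: c. Qed.

Lemma ReM (c d : R[i]) : 0 <= c -> complex.Re (c * d) = complex.Re c * complex.Re d.
Proof. by move=> /ger0_Im; case: c d => [a b] [a' b'] /= ->; rewrite mul0r subr0. Qed.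

Lemma ReMi a b (d : R[i]) :
  complex.Re ((a +i* b) * d) = a * complex.Re d - b * complex.Im d.
Proof. by case: d. Qed.

Lemma ImMi a b (d : R[i]) :
  complex.Im ((a +i* b) * d) = a * complex.Im d + b * complex.Re d.
Proof. by case: d. Qed.

Lemma ReIm (c : R[i]) : complex.Re c +i* complex.Im c = c.
Proof. by case: c. Qed.

Lemma conjE (c : R[i]) : Num.conj c = complex.Re c -i* complex.Im c.
Proof. by case: c. Qed.

Definition sqn x : R := complex.Re (inner x x).

Lemma sqnE x : (sqn x)%:C = inner x x.
Proof. exact/ReK/inner_ge0. Qed.

Lemma sqn_ge0 x : 0 <= sqn x.
Proof. exact/Re_ge0/inner_ge0. Qed.

Lemma sqnZ (c : R[i]) x : sqn (c *: x) = complex.Re (`|c| ^+ 2) * sqn x.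
Proof.
by rewrite /sqn [X in complex.Re X = _]dnormZ ReM ?exprn_ge0.
Qed.

Lemma sqnD x y : sqn (x + y) = sqn x + sqn y + 2 * complex.Re (inner x y).
Proof.
by rewrite /sqn [X in complex.Re X = _]dnormD /= !ReD conjE mulrDl mul1r.
Qed.

Lemma sqnN x : sqn (- x) = sqn x.
Proof. by rewrite /sqn [X in complex.Re X = _]hnormN. Qed.

Lemma normRe_inner x y : `|complex.Re (inner x y)| <= sqn x + sqn y.
Proof.
have h a b : - complex.Re (inner a b) <= sqn a + sqn b.
  have := sqn_ge0 (a + b); rewrite sqnD => h.
  have ab : 0 <= sqn a + sqn b by rewrite addr_ge0 ?sqn_ge0.
  rewrite -subr_ge0 opprK.
  have [r0|r0] := leP 0 (complex.Re (inner a b)); first by rewrite addr_ge0.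
  apply: le_trans h _; rewrite lerD2l mulrDl mul1r gerDl; exact: ltW.
rewrite ler_norml; apply/andP; split; first by rewrite lerNl h.
have := h x (- y); rewrite sqnN; rewrite linearNr ReN opprK; exact.
Qed.

Lemma normIm_inner x y : `|complex.Im (inner x y)| <= sqn x + sqn y.
Proof.
have := normRe_inner x ('i *: y).
have -> : sqn ('i *: y) = sqn y.
  have n1 : `|'i : R[i]| = 1.
    by rewrite normc_def /= expr0n /= add0r expr1n sqrtr1.
  by rewrite sqnZ n1 expr1n mul1r.
have -> : complex.Re (inner x ('i *: y)) = complex.Im (inner x y); last by [].
by rewrite linearZr_LR /=; case: (inner x y) => a b /=; simpc => /=; rewrite ?mul0r ?sub0r ?mulN1r ?opprK ?mul1r.
Qed.

(* [ell2 I E] is the Hilbert space of the families [f : I -> E] such that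
   \sum_i |f i|^2 < +oo, with inner product \sum_i <f i, g i>. *)
Definition square_summable f := summable_family (fun i => complex.Re (inner (f i) (f i))).

Definition ell2_pred : {pred I -> E} := [pred f | `[< square_summable f >]].

Record ell2 := Ell2 { ell2_fun :> I -> E ; _ : ell2_fun \in ell2_pred }.

HB.instance Definition _ := [isSub for ell2_fun].
HB.instance Definition _ := [Choice of ell2 by <:].

Lemma square_summableP f : reflect (square_summable f) (f \in ell2_pred).
Proof. by rewrite inE; exact: asboolP. Qed.

Lemma ell2P (F : ell2) : summable_family (fun i => sqn (F i)).
Proof. by apply/square_summableP; case: F. Qed.
Arguments ell2P F : clear implicits.

Lemma ell2_submod_closed : submod_closed ell2_pred.
Proof.
split=> [|c f g /square_summableP sf /square_summableP sg]; apply/square_summableP.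
  rewrite /square_summable (_ : (fun i => _) = fun=> 0); first exact: summable_family0.
  by apply/funext => i; rewrite [inner _ _]linear0l.
apply: (@summable_family_le _ _ _
    ((fun i => (2 * complex.Re (`|c| ^+ 2)) * sqn (f i)) \+ (fun i => 2 * sqn (g i)))).
  move=> i; rewrite ger0_norm ?sqn_ge0 //=.
  have -> : (c *: f + g) i = c *: f i + g i by [].
  have := normRe_inner (c *: f i) (g i); rewrite -/(sqn _) sqnD sqnZ.
  move=> /(le_trans (ler_norm _)) h.
  rewrite -mulrA -mulrDr [leRHS]mulrDl mul1r lerD2l.
  have := sqn_ge0 (c *: f i - g i); rewrite sqnD sqnN sqnZ [inner _ _]linearNr ReN.
  by rewrite mulrN subr_ge0.
by apply: summable_familyD; apply: summable_familyZ.
Qed.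

HB.instance Definition _ := GRing.isSubmodClosed.Build _ _ ell2_pred ell2_submod_closed.
HB.instance Definition _ := [SubChoice_isSubLmodule of ell2 by <:].

Implicit Types F G H : ell2.

Lemma ell2_ext F G : F =1 G -> F = G.
Proof. by move=> FG; apply/val_inj/funext. Qed.

Lemma ell2D F G i : (F + G) i = F i + G i. Proof. by []. Qed.
Lemma ell2N F i : (- F) i = - F i. Proof. by []. Qed.
Lemma ell2Z c F i : (c *: F) i = c *: F i. Proof. by []. Qed.

(* the real and imaginary parts of \sum_i <F i, G i> *)
Definition ell2_inner F G : R[i] :=
  family_sum (fun i => complex.Re (inner (F i) (G i)))
  +i* family_sum (fun i => complex.Im (inner (F i) (G i))).

Lemma summable_Re_inner F G :
  summable_family (fun i => complex.Re (inner (F i) (G i))).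
Proof.
apply: (summable_family_le _ (summable_familyD (ell2P F) (ell2P G))) => i.
exact: normRe_inner.
Qed.
Arguments summable_Re_inner F G : clear implicits.

Lemma summable_Im_inner F G :
  summable_family (fun i => complex.Im (inner (F i) (G i))).
Proof.
apply: (summable_family_le _ (summable_familyD (ell2P F) (ell2P G))) => i.
exact: normIm_inner.
Qed.
Arguments summable_Im_inner F G : clear implicits.

Lemma ell2_innerC F G : ell2_inner F G = Num.conj (ell2_inner G F).
Proof.
rewrite conjE /ell2_inner /=; congr (_ +i* _).
  by congr family_sum; apply/funext => i; rewrite hermC mul1r /= conjE.
rewrite -[RHS]mulN1r -family_sumZ; last exact: summable_Im_inner.
by congr family_sum; apply/funext => i; rewrite hermC mul1r /= conjE /= mulN1r.
Qed.

Lemma ell2_innerDl F G H : ell2_inner (F + G) H = ell2_inner F H + ell2_inner G H.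
Proof.
rewrite /ell2_inner; simpc; congr (_ +i* _).
  rewrite -family_sumD; [|exact: summable_Re_inner..].
  by congr family_sum; apply/funext => i; rewrite ell2D linearDl ReD.
rewrite -family_sumD; [|exact: summable_Im_inner..].
by congr family_sum; apply/funext => i; rewrite ell2D linearDl ImD.
Qed.

Lemma ell2_innerZl c F G : ell2_inner (c *: F) G = c * ell2_inner F G.
Proof.
have sRe a := summable_familyZ a (summable_Re_inner F G).
have sIm a := summable_familyZ a (summable_Im_inner F G).
case: c => a b; rewrite /ell2_inner; simpc; congr (_ +i* _).
  rewrite -mulNr -(family_sumZ _ (summable_Re_inner F G)).
  rewrite -(family_sumZ _ (summable_Im_inner F G)) -family_sumD //.
  congr family_sum; apply/funext => i; rewrite ell2Z linearZl_LR /=.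
  by rewrite ReMi mulNr.
rewrite -(family_sumZ _ (summable_Re_inner F G)).
rewrite -(family_sumZ _ (summable_Im_inner F G)) -family_sumD //.
congr family_sum; apply/funext => i; rewrite ell2Z linearZl_LR /=.
by rewrite ImMi.
Qed.

Lemma ell2_inner_bilinear :
  bilinear_for (GRing.Scale.Law.clone _ _ *%R _)
    (GRing.Scale.Law.clone _ _ (Num.conj \; *%R) _) ell2_inner.
Proof.
split=> [G|F] c H K /=; first by rewrite ell2_innerDl ell2_innerZl.
by rewrite ell2_innerC ell2_innerDl ell2_innerZl rmorphD rmorphM /= -!ell2_innerC.
Qed.

HB.instance Definition _ := bilinear_isBilinear.Build R[i] ell2 ell2 R[i]
  _ _ ell2_inner ell2_inner_bilinear.

Lemma ell2_inner_hermitian F G :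
  ell2_inner F G = (-1) ^+ false * Num.conj (ell2_inner G F).
Proof. by rewrite mul1r; exact: ell2_innerC. Qed.

HB.instance Definition _ := isHermitianSesquilinear.Build R[i] ell2 false
  (@Num.conj R[i]) ell2_inner ell2_inner_hermitian.

Lemma ell2_inner_real F : ell2_inner F F = (family_sum (fun i => sqn (F i)))%:C.
Proof.
congr (_ +i* _).
rewrite (_ : (fun i => _) = (fun i => 0 * sqn (F i))).
  by rewrite family_sumZ ?mul0r //; exact: ell2P.
by apply/funext => i; rewrite mul0r -sqnE.
Qed.

Lemma ell2_inner_gt0 F : F != 0 -> 0 < ell2_inner F F.
Proof.
rewrite ell2_inner_real ltcR lt_def family_sum_ge0 ?andbT => [F0||]; first last.
- exact: ell2P.
- by move=> i; exact: sqn_ge0.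
apply: contra F0 => /eqP F0; apply/eqP/ell2_ext => i.
have := family_sum_eq0 (fun i => sqn_ge0 (F i)) (ell2P F) F0 i.
by move=> /(congr1 (real_complex R)); rewrite /= sqnE => /eqP; rewrite dnorm_eq0 => /eqP.
Qed.

HB.instance Definition _ := isDotProduct.Build R[i] ell2 ell2_inner ell2_inner_gt0.

Definition ell2_dot : {dot ell2 for @Num.conj R[i]} := ell2_inner.

Definition ell2_norm F : R[i] := sqrtC (ell2_inner F F).

Lemma ell2_normD F G : ell2_norm (F + G) <= ell2_norm F + ell2_norm G.
Proof. exact: (dot_sqrtC_triangle ell2_dot). Qed.

Lemma ell2_normZ c F : ell2_norm (c *: F) = `|c| * ell2_norm F.
Proof.
rewrite /ell2_norm (dnormZ ell2_dot) sqrtCM ?nnegrE ?exprn_ge0 //.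
by rewrite sqrCK.
Qed.

Lemma ell2_norm0_eq0 F : ell2_norm F = 0 -> F = 0.
Proof.
by move=> /eqP; rewrite sqrtC_eq0 => /eqP; move/eqP; rewrite (dnorm_eq0 ell2_dot) => /eqP.
Qed.

HB.instance Definition _ := Lmodule_isNormed.Build R[i] ell2
  ell2_normD ell2_normZ ell2_norm0_eq0.

Lemma ell2_inner_norm F : ell2_dot F F = `|F| ^+ 2.
Proof. by rewrite /Num.norm /= /ell2_norm sqrtCK. Qed.

Lemma sqn_norm x : (sqn x)%:C = `|x| ^+ 2.
Proof. by rewrite sqnE inner_norm. Qed.

Lemma ell2_sqr_norm F : `|F| ^+ 2 = (family_sum (fun i => sqn (F i)))%:C.
Proof. by rewrite -ell2_inner_norm; exact: ell2_inner_real. Qed.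

Lemma norm_lt_sqn x (r : R) : 0 <= r -> (`|x| < r%:C) = (sqn x < r ^+ 2).
Proof.
move=> r0; rewrite -ltcR sqn_norm rmorphXn /=.
by rewrite ltr_pXn2r ?nnegrE ?ler0c.
Qed.

Lemma ell2_norm_lt F (r : R) : 0 <= r ->
  (`|F| < r%:C) = (family_sum (fun i => sqn (F i)) < r ^+ 2).
Proof.
move=> r0; rewrite -ltcR -ell2_sqr_norm rmorphXn /=.
by rewrite ltr_pXn2r ?nnegrE ?ler0c.
Qed.

Lemma ell2_le_norm F i : `|F i| <= `|F|.
Proof.
rewrite -(@ler_pXn2r _ 2) ?nnegrE // -sqn_norm ell2_sqr_norm lecR.
rewrite -[sqn (F i)](big_seq1 +%R i (fun i => sqn (F i))).
apply: finite_sum_le_family_sum => // [j|]; first exact: sqn_ge0.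
exact: ell2P.
Qed.

Lemma sqnD_le x y : sqn (x + y) <= 2 * sqn x + 2 * sqn y.
Proof.
have := sqn_ge0 (x - y); rewrite !sqnD sqnN linearNr ReN mulrN subr_ge0 => h.
by rewrite -mulrDr [leRHS]mulrDl mul1r lerD2l.
Qed.

Lemma ell2_complete (F : set_system ell2) : ProperFilter F -> cauchy F -> cvg F.
Proof.
move=> FF /cauchyP Fc.
have Fcoord i : cvg ((fun G : ell2 => G i) @ F).
  apply: cauchy_cvg; apply/cauchyP => e e0.
  have [G FG] := Fc e e0; exists (G i).
  suff: F ((fun H : ell2 => H i) @^-1` ball (G i) e) by [].
  apply: filterS FG => H; rewrite -!ball_normE /=.
  exact: (le_lt_trans (ell2_le_norm (G - H) i)).
pose l i := lim ((fun G : ell2 => G i) @ F).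
have Fl i (M : R) : 0 < M -> \forall H \near F, sqn ((H : ell2) i - l i) < M.
  move=> M0; have /cvgrPdist_lt/(_ (Num.sqrt M)%:C) := Fcoord i.
  rewrite ltcR sqrtr_gt0 => /(_ M0); apply: filterS => H.
  by rewrite distrC norm_lt_sqn ?sqrtr_ge0 // sqr_sqrtr // ltW.
have Fls (s : seq I) (M : R) : 0 < M ->
    \forall H \near F, \sum_(i <- s) sqn ((H : ell2) i - l i) < M.
  elim: s M => [|i s IH] M M0; first by apply: nearW => H; rewrite big_nil.
  have M2 : 0 < M / 2 by rewrite divr_gt0.
  apply: filterS2 (Fl i _ M2) (IH _ M2) => H h1 h2.
  by rewrite big_cons [M]splitr ltrD.
have dist r G : 0 < r -> F (ball G r%:C) -> forall s : seq I, uniq s ->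
    \sum_(i <- s) sqn (G i - l i) <= 4 * r ^+ 2.
  move=> r0 FG s us.
  have [H [GH Hl]] : exists H : ell2, ball G r%:C H /\ \sum_(i <- s) sqn (H i - l i) < r ^+ 2.
    by apply: (@filter_ex _ F); apply: filterI FG (Fls s _ _); rewrite exprn_gt0.
  have {}GH : \sum_(i <- s) sqn (G i - H i) <= r ^+ 2.
    move: GH; rewrite -ball_normE /= (ell2_norm_lt _ (ltW r0)) => /ltW.
    apply: le_trans.
    apply: (@finite_sum_le_family_sum _ _ (fun i => sqn ((G - H) i))) => //.
      by move=> i; exact: sqn_ge0.
    exact: ell2P.
  apply: (@le_trans _ _ (\sum_(i <- s) (2 * sqn (G i - H i) + 2 * sqn (H i - l i)))).
    apply: ler_sum => i _.
    by rewrite (_ : G i - l i = (G i - H i) + (H i - l i)) ?sqnD_le // addrA subrK.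
  rewrite big_split /= -!mulr_sumr -mulrDr.
  have -> : 4 * r ^+ 2 = 2 * (r ^+ 2 + r ^+ 2) by ring.
  by rewrite ler_pM2l ?ltr0n //; apply: lerD => //; exact: ltW.
have distl r G : 0 < r -> F (ball G r%:C) ->
    exists2 K : ell2, (forall i, K i = G i - l i) & `|K| < (3 * r)%:C.
  move=> r0 FG.
  have sK : (fun i => G i - l i) \in ell2_pred.
    apply/square_summableP.
    apply: summable_family_bounded (dist r G r0 FG) => i.
    exact: sqn_ge0.
  exists (Ell2 sK) => //; rewrite ell2_norm_lt; last by rewrite mulr_ge0 ?ltW.
  apply: le_lt_trans (family_sum_le _ (dist r G r0 FG)) _.
    by move=> i; exact: sqn_ge0.
  by rewrite exprMn ltr_pM2r ?exprn_gt0 //; lra.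
have r1 : (0 : R) < 1 by [].
have [G1 FG1] : exists G, F (ball G (1 : R)%:C) by apply: Fc; rewrite ltcR.
have [K1 K1E _] := distl _ _ r1 FG1.
pose L : ell2 := G1 - K1.
have LE i : L i = l i by rewrite ell2D ell2N K1E opprB addrC subrK.
apply/cvg_ex; exists L; apply/cvgrPdist_lt => e e0.
pose r := complex.Re e / 4.
have re : (4 * r)%:C = e by rewrite /r mulrC divfK ?pnatr_eq0 // ReK // ltW.
have r0 : 0 < r.
  by rewrite divr_gt0 // -ltcR ReK // ltW.
have [G FG] : exists G, F (ball G r%:C) by apply: Fc; rewrite ltcR.
have [K KE Kr] := distl _ _ r0 FG.
have KL : K = G - L by apply: ell2_ext => i; rewrite KE ell2D ell2N LE.
apply: filterS FG => H; rewrite -ball_normE /= => GH.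
rewrite (_ : L - H = (G - H) - K); last by rewrite KL opprB [RHS]addrC addrA subrK.
apply: le_lt_trans (ler_normB _ _) _.
rewrite -re (_ : 4 * r = r + 3 * r); last by ring.
by rewrite rmorphD ltrD.
Qed.

HB.instance Definition _ := Uniform_isComplete.Build ell2 ell2_complete.
HB.instance Definition _ := isHilbert.Build R ell2 ell2_inner_norm.

Definition ell2_single_fun (i : I) (x : E) : I -> E := fun j => if j == i then x else 0.

Lemma ell2_single_subproof i x : ell2_single_fun i x \in ell2_pred.
Proof.
apply/square_summableP; apply: (@summable_family_bounded _ _ _ (sqn x)).
  by move=> j; exact: sqn_ge0.
move=> s us; have [is_|is_] := boolP (i \in s).
  rewrite (bigD1_seq i) //= /ell2_single_fun eqxx big1 ?addr0 //.
  by move=> j /negPf ->; rewrite linear0l.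
rewrite big_seq big1 ?sqn_ge0 // => j js.
rewrite /ell2_single_fun ifN ?linear0l //.
by apply: contraNneq is_ => <-.
Qed.

Definition ell2_single i x : ell2 := Ell2 (ell2_single_subproof i x).

Lemma ell2_single_is_linear i : linear (ell2_single i).
Proof.
move=> c x y; apply: ell2_ext => j; rewrite ell2D ell2Z /= /ell2_single_fun.
by case: eqP; rewrite ?scaler0 ?addr0.
Qed.

HB.instance Definition _ i :=
  GRing.isLinear.Build R[i] E ell2 *:%R (ell2_single i) (ell2_single_is_linear i).

Lemma family_sum_delta (u : I -> R) i : (forall j, j != i -> u j = 0) ->
  family_sum u = u i.
Proof.
move=> ui; apply: cvg_lim => //.
apply: cvg_near_cst; exists (pickle i).+1 => // n /= lt_in.
have it : i \in pmap (@pickle_inv I) (iota 0 n).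
  rewrite mem_pmap; apply/mapP; exists (pickle i); last by rewrite pickleK_inv.
  by rewrite mem_iota add0n; exact: lt_in.
rewrite series_enum_familyE (bigD1_seq i it) ?uniq_pmap_pickle_inv //=.
by rewrite big1 ?addr0.
Qed.

Lemma inner_singler F i x : inner F (ell2_single i x) = inner (F i) x.
Proof.
have h (p : R[i] -> R) : p 0 = 0 ->
    family_sum (fun j => p (inner (F j) (ell2_single i x j))) = p (inner (F i) x).
  move=> p0; rewrite (@family_sum_delta _ i) /= ?/ell2_single_fun ?eqxx //.
  by move=> j /negPf ->; rewrite linear0r.
by rewrite -[RHS]ReIm -(h (@complex.Re R)) // -(h (@complex.Im R)).
Qed.

Lemma inner_single i j x y :
  inner (ell2_single i x) (ell2_single j y) = if i == j then inner x y else 0.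
Proof.
rewrite inner_singler /= /ell2_single_fun eq_sym.
by case: eqP => // _; rewrite linear0l.
Qed.

End Ell2.
Arguments ell2_pred {R I E}.

Section LinearSpan.
Variables (K : numFieldType) (V : normedModType K).

Definition linear_span (A : set V) : set V :=
  [set x | exists (m : nat) (c : 'I_m -> K) (v : 'I_m -> V),
             (forall k, A (v k)) /\ x = \sum_(k < m) c k *: v k].

Lemma eq_on_closed_span (W : normedModType K) (f g : {linear V -> W}) (A : set V) :
  continuous f -> continuous g -> (forall x, A x -> f x = g x) ->
  forall x, closure (linear_span A) x -> f x = g x.
Proof.
move=> cf cg fg x xA; apply/eqP; rewrite -subr_eq0 -normr_le0.
apply/ler_addgt0Pr => e e0; rewrite add0r.
have e2 : 0 < e / 2 by rewrite divr_gt0.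
have /cvgrPdist_lt/(_ _ e2) nf := cf x; have /cvgrPdist_lt/(_ _ e2) ng := cg x.
have [y [[m [c [v [Av ->]]]] [hf hg]]] := xA _ (filterI nf ng).
set y0 := \sum_(k < m) _ in hf hg.
have y0E : f y0 = g y0.
  by rewrite /y0 !linear_sum; apply: eq_bigr => k _; rewrite !linearZ /= fg.
rewrite (_ : f x - g x = (f x - f y0) - (g x - g y0)); last first.
  by rewrite y0E opprB addrA subrK.
apply: le_trans (ler_normB _ _) _; rewrite [e]splitr.
by apply: lerD; exact: ltW.
Qed.

End LinearSpan.

Section Operators.
Variables (K : numFieldType) (V W : normedModType K).

(* for linear maps this is |f x| <= r * |x| for some r (linear_boundedP) *)
Definition bounded_operator (f : {linear V -> W}) := bounded_near f (nbhs (0 : V)).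

Definition isometric_operator (f : {linear V -> W}) := forall x, `|f x| = `|x|.

End Operators.

Definition separable_space (T : topologicalType) :=
  exists2 D : set T, countable D & dense D.

(* A \ominus B *)
Definition ominus (R : realType) (H : hilbertType R) (A B : set H) : set H :=
  [set x | A x /\ forall y, B y -> inner x y = 0].

Lemma ell2_sum (R : realType) (I : countType) (E : hilbertType R) (J : Type)
    (s : seq J) (F : J -> ell2 I E) i :
  (\sum_(j <- s) F j) i = \sum_(j <- s) F j i.
Proof. by elim: s => [|j s IH]; rewrite ?big_nil // !big_cons ell2D IH. Qed.

Lemma closed_span_single (R : realType) (I : countType) (E : hilbertType R)
    (F : ell2 I E) :
  closure (linear_span [set x | exists i eta, x = ell2_single i eta]) F.
Proof.
move=> B /nbhs_ballP [e /= e0 eB].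
pose r := complex.Re e.
have re : r%:C = e by rewrite ReK // ltW.
have r0 : 0 < r by rewrite -ltcR re.
pose u i := sqn (F i).
have u0 i : 0 <= u i by exact: sqn_ge0.
have su : summable_family u by exact: ell2P.
have /cvgrPdist_lt/(_ (r ^+ 2)) := su; rewrite exprn_gt0 // => /(_ isT)[n _ /(_ n)].
rewrite /= leqnn => /(_ isT); rewrite series_enum_familyE.
have := uniq_pmap_pickle_inv I n; set s := pmap _ _ => us.
move=> /(le_lt_trans (ler_norm _)); rewrite -/(family_sum u) => ltr.
pose G := \sum_(i <- s) ell2_single i (F i).
have GE j : G j = if j \in s then F j else 0.
  rewrite /G ell2_sum /= /ell2_single_fun; case: ifP => js.
    rewrite (bigD1_seq j) //= eqxx big1 ?addr0 // => i.
    by rewrite eq_sym => /negPf ->.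
  rewrite big_seq big1 // => i is_; case: eqP => // ij.
  by rewrite ij is_ in js.
exists G; split; last first.
  apply: eB; rewrite -ball_normE /= -re ell2_norm_lt ?ltW //.
  apply: le_lt_trans ltr; apply: family_sum_le => [i|t ut]; first exact: sqn_ge0.
  rewrite lerBrDl.
  apply: (@le_trans _ _ (\sum_(i <- s ++ [seq i <- t | i \notin s]) u i)); last first.
    apply: finite_sum_le_family_sum => //; rewrite cat_uniq us filter_uniq // andbT.
    by apply/hasPn => i /=; rewrite mem_filter => /andP[].
  rewrite big_cat lerD2l big_filter [leRHS]big_mkcond /=; apply: ler_sum => i _.
  rewrite -[leLHS]/(sqn (F i - G i)) GE; case: ifP => is_ /=; rewrite ?subrr ?subr0 //.
  by rewrite /sqn linear0l.
exists (size s), (fun=> 1), (fun k => ell2_single (tnth (in_tuple s) k) (F (tnth (in_tuple s) k))).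
split; first by move=> k; do 2 eexists.
by rewrite /G big_tnth; apply: eq_bigr => k _; rewrite scale1r.
Qed.

(* The free semigroup on n letters is [seq 'I_n], with identity [::]. The space
   F^2_n (x) H is realized as the Hilbert space of square-summable families
   f : seq 'I_n -> H, the family f standing for \sum_mu e_mu (x) f mu. The
   vectors [ket mu eta] are the elementary tensors e_mu (x) eta: by
   [inner_ket] and [closed_span_ket] they have the inner products
   <e_mu, e_nu> <eta, zeta> and they span a dense subspace. *)
Notation fock_tensor n H := (ell2 (seq 'I_n) H).

Section Fock.
Variables (R : realType) (n : nat) (H : hilbertType R).

Definition ket (mu : seq 'I_n) (eta : H) : fock_tensor n H := ell2_single mu eta.

Lemma inner_ket mu nu (eta zeta : H) :
  inner (ket mu eta) (ket nu zeta) = if mu == nu then inner eta zeta else 0.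
Proof. exact: inner_single. Qed.

Lemma closed_span_ket (F : fock_tensor n H) :
  closure (linear_span [set x | exists mu eta, x = ket mu eta]) F.
Proof. exact: closed_span_single. Qed.

Definition creation_fun (i : 'I_n) (f : seq 'I_n -> H) (mu : seq 'I_n) : H :=
  if mu is j :: nu then (if j == i then f nu else 0) else 0.

Lemma creation_subproof i (F : fock_tensor n H) : creation_fun i F \in ell2_pred.
Proof.
apply/square_summableP.
apply: (@summable_family_bounded _ _ _ (family_sum (fun mu => sqn (F mu)))).
  by move=> mu; exact: sqn_ge0.
move=> s us.
pose t := pmap (fun mu => if mu is j :: nu then (if j == i then Some nu else None) else None) s.
have -> : \sum_(mu <- s) complex.Re (inner (creation_fun i F mu) (creation_fun i F mu))
    = \sum_(nu <- t) sqn (F nu).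
  rewrite /t; elim: s {us t} => [|mu s IH] /=; first by rewrite !big_nil.
  rewrite big_cons IH; case: mu => [|j nu] /=; first by rewrite linear0l add0r.
  by case: eqP => _ /=; rewrite ?big_cons ?linear0l ?add0r.
apply: finite_sum_le_family_sum => [mu||].
- exact: sqn_ge0.
- exact: ell2P.
apply: (@pmap_uniq _ _ _ (fun nu => i :: nu)) us => -[|j nu] //=.
by case: eqP => //= ->.
Qed.

(* S_i (x) I_H: it maps e_nu (x) eta to e_(i nu) (x) eta, see [creation_ket] *)
Definition creation i (F : fock_tensor n H) : fock_tensor n H := Ell2 (creation_subproof i F).

Lemma creation_is_linear i : linear (creation i).
Proof.
move=> c F G; apply: ell2_ext => -[|j nu]; rewrite ell2D ell2Z /=.
  by rewrite scaler0 addr0.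
by case: eqP; rewrite ?scaler0 ?addr0.
Qed.

HB.instance Definition _ i :=
  GRing.isLinear.Build R[i] (fock_tensor n H) (fock_tensor n H) *:%R (creation i) (creation_is_linear i).

Lemma creation_ket i mu eta : creation i (ket mu eta) = ket (i :: mu) eta.
Proof.
apply: ell2_ext => -[|j nu] //=; rewrite /ell2_single_fun /= eqseq_cons.
by case: eqP.
Qed.

(* S^H = (S_1 (x) I_H, ..., S_n (x) I_H) *)
Definition creation_tuple (i : 'I_n) : {linear fock_tensor n H -> fock_tensor n H} :=
  creation i.

End Fock.

(* From here on the number of generators is n.+1, that is, at least 1. The
   letters g_1, ..., g_(n.+1) are the elements ord0, ..., ord_max of 'I_n.+1. *)
Section Odometer.
Variables (R : realType) (n : nat).

Definition odometer_representation (H : hilbertType R) (W : {linear H -> H})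
    (T : 'I_n.+1 -> {linear H -> H}) : Prop :=
  [/\ bounded_operator W,
      forall i, bounded_operator (T i),
      forall (i i' : 'I_n.+1) x, i' = i.+1 :> nat -> W (T i x) = T i' x
    & forall x, W (T ord_max x) = T ord0 (W x)].

Variable H : hilbertType R.
Local Notation K := (fock_tensor n.+1 H).
Implicit Types (L : {linear H -> K}) (W : {linear K -> K}).

(* e_1^(x)m (x) v, that is, (S_1^m (x) I_H) v *)
Definition shift1 (m : nat) (v : K) : K := iter m (creation ord0) v.

(* [W] is the odometer map with symbol [L]. It is unique, but depending on [L]
   there may be no bounded operator with these values. *)
Definition is_odometer_map L W : Prop :=
  [/\ bounded_operator W,
      forall eta, W (ket [::] eta) = L eta,
      forall m eta, (0 < m)%N -> W (ket (nseq m ord_max) eta) = shift1 m (L eta)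
    & forall j (i i' : 'I_n.+1) nu eta, i' = i.+1 :> nat ->
        W (ket (nseq j ord_max ++ i :: nu) eta) = ket (nseq j ord0 ++ i' :: nu) eta].

Lemma is_odometer_map_unique L W1 W2 :
  is_odometer_map L W1 -> is_odometer_map L W2 -> W1 =1 W2.
Proof.
move=> [b1 o1 m1 j1] [b2 o2 m2 j2] F.
apply: (@eq_on_closed_span _ _ _ _ _ [set x | exists mu eta, x = ket mu eta]);
  [exact: bounded_linear_continuous..| |exact: closed_span_ket].
move=> _ [mu [eta ->]].
have [m [->|[i [nu [ltin ->]]]]] : exists m, mu = nseq m ord_max \/
    exists (i : 'I_n.+1) nu, (i < n)%N /\ mu = nseq m (@ord_max n) ++ i :: nu.
- elim: mu => [|i mu [m IH]]; first by exists 0%N; left.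
  have [->|ine] := eqVneq i ord_max.
    exists m.+1; case: IH => [->|[k [nu [kn ->]]]]; first by left.
    by right; exists k, nu.
  exists 0%N; right; exists i, mu; split=> //.
  by rewrite ltn_neqAle -ltnS ltn_ord andbT; apply: contra_neq ine => h; exact: val_inj.
- by case: m => [|m]; [rewrite o1 o2|rewrite m1 ?m2].
- by rewrite (j1 _ _ (inord i.+1)) ?(j2 _ _ (inord i.+1)) // inordK.
Qed.

Definition isometric_fock_representation W : Prop :=
  odometer_representation W (@creation_tuple R n.+1 H) /\ isometric_operator W.

Definition symbol_space L : set K :=
  ominus
    (closure (linear_span [set x | exists m eta, x = ket (nseq m ord0) eta]))
    (closure (linear_span
      [set x | exists p zeta, (1 <= p)%N /\ x = shift1 p (L zeta)])).

End Odometer.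

(* Main.v *)
(* The vectors e_mu (x) eta are carried by the odometer map either to an
   elementary tensor e_lam (x) eta, where lam is the successor of mu in the
   adding machine and contains a letter other than g_1, or, when the carry
   leaves the word (mu = g_n^m), to e_1^m (x) L eta. Such a family extends to an
   isometry exactly when its vectors have the inner products of the
   e_mu (x) eta. Since the successor map is a bijection onto the words that
   contain a letter other than g_1, orthogonality to the e_lam (x) zeta puts
   L eta in the closed span of the e_1^m (x) zeta, and the vectors
   e_1^m (x) L eta for different m are orthogonal exactly when every L eta is
   orthogonal to all e_1^p (x) L zeta with p >= 1. *)

Require Import Defs.
From HB Require Import structures.
From mathcomp Require Import all_boot all_order all_algebra.
From mathcomp Require Import complex.
From mathcomp Require Import boolp classical_sets functions cardinality.
From mathcomp Require Import reals topology normedtype sequences.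

Set Implicit Arguments.
Unset Strict Implicit.
Unset Printing Implicit Defensive.

Import Order.TTheory GRing.Theory Num.Theory.
Import numFieldNormedType.Exports.

Local Open Scope classical_set_scope.
Local Open Scope ring_scope.
Local Open Scope complex_scope.

(** * Inner products, isometries and closed spans *)

Section Isometries.
Variables (R : realType).

Lemma inner_linearl (H : hilbertType R) (y : H) :
  linear (fun x => inner x y : R[i]^o).
Proof. by move=> c x z; rewrite linearDl linearZl_LR. Qed.

Lemma innerC0 (H : hilbertType R) (x y : H) : inner x y = 0 -> inner y x = 0.
Proof. by move=> xy; rewrite hermC /= xy rmorph0 mulr0. Qed.

Lemma eqr_sqr_norm (U V : normedModType R[i]) (x : U) (y : V) :
  `|x| ^+ 2 = `|y| ^+ 2 -> `|x| = `|y|.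
Proof. by move/eqP; rewrite eqrXn2 // => /eqP. Qed.

Lemma inner_le_norm (H : hilbertType R) (x y : H) : `|inner x y| <= `|x| * `|y|.
Proof.
rewrite -(@ler_pXn2r _ 2) ?nnegrE ?mulr_ge0 // exprMn -!inner_norm.
exact: dot_CauchySchwarz.
Qed.

Lemma linear_le_norm_bounded (U V : normedModType R[i]) (f : {linear U -> V}) (c : R[i]) :
  0 <= c -> (forall x, `|f x| <= c * `|x|) -> bounded_operator f.
Proof.
move=> c0 fc; apply/linear_boundedP; exists c; split; first exact: ger0_real.
by move=> r /ltW cr x; apply: le_trans (fc x) _; rewrite ler_wpM2r.
Qed.

Lemma isometric_bounded (U V : normedModType R[i]) (f : {linear U -> V}) :
  isometric_operator f -> bounded_operator f.
Proof.
by move=> fiso; apply: (@linear_le_norm_bounded _ _ _ 1) => // x; rewrite mul1r fiso.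
Qed.

(** Polarization: expanding the squared norm of [x + y] recovers the real part of the inner product,
    and the imaginary part is the real part with ['i *: y] in place of [y]. *)
Lemma isometric_inner (H K : hilbertType R) (f : {linear H -> K}) :
  isometric_operator f -> forall x y, inner (f x) (f y) = inner x y.
Proof.
move=> fiso.
have fsqn x : sqn (f x) = sqn x.
  by apply: (@complexI R); rewrite !sqn_norm fiso.
have fRe x y : complex.Re (inner (f x) (f y)) = complex.Re (inner x y).
  have := fsqn (x + y); rewrite linearD !sqnD !fsqn => /addrI.
  by apply: mulfI; rewrite pnatr_eq0.
have ImRe (G : hilbertType R) (x y : G) :
    complex.Im (inner x y) = complex.Re (inner x ('i *: y)).
  rewrite linearZr_LR /=; case: (inner x y) => a b /=.
  by simpc => /=; rewrite ?mul0r ?sub0r ?mulN1r ?opprK ?mul1r.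
move=> x y; rewrite -[LHS]ReIm -[RHS]ReIm fRe; congr (_ +i* _).
by rewrite !ImRe -linearZ fRe.
Qed.

(** By Cauchy-Schwarz the functional [inner ^~ y] is bounded, hence continuous, so it can be
    compared with the zero map on [A] alone. *)
Lemma closed_span_ortho (H : hilbertType R) (A : set H) (y : H) :
  (forall x, A x -> inner x y = 0) ->
  forall x, closure (linear_span A) x -> inner x y = 0.
Proof.
move=> Ay.
pose f : {linear H -> R[i]^o} :=
  HB.pack (fun x => inner x y : R[i]^o) (GRing.isLinear.Build _ _ _ _ _ (inner_linearl y)).
pose g : {linear H -> R[i]^o} := \0.
suff cf : continuous f.
  move=> x /(eq_on_closed_span (g := g) cf _ Ay); apply; exact: cst_continuous.
apply/bounded_linear_continuous/(@linear_le_norm_bounded _ _ f `|y|) => // x.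
by rewrite mulrC; exact: inner_le_norm.
Qed.

Lemma sqr_norm_sum_ortho (H : hilbertType R) (J : eqType) (s : seq J) (v : J -> H) :
  uniq s -> (forall j k, j != k -> inner (v j) (v k) = 0) ->
  `|\sum_(j <- s) v j| ^+ 2 = \sum_(j <- s) `|v j| ^+ 2.
Proof.
move=> + vo; elim: s => [|j s IH] /=; first by rewrite !big_nil normr0 expr0n.
case/andP=> js us; rewrite !big_cons -IH // -!inner_norm hnormDd //.
rewrite linear_sumr big_seq big1 //= => k ks.
by apply: vo; apply: contraNneq js => ->.
Qed.

Lemma cvg_real_complex (u : nat -> R) (l : R) :
  u @ \oo --> l ->
  (fun k => (u k)%:C : (R[i] : numFieldType)) @ \oo --> (l%:C : (R[i] : numFieldType)).
Proof.
move=> /cvgrPdist_lt ul; apply/cvgrPdist_lt => e e0.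
have re : (complex.Re e)%:C = e by rewrite ReK // ltW.
have r0 : 0 < complex.Re e by rewrite -ltcR re.
apply: filterS (ul _ r0) => k.
by rewrite -rmorphB /= normc_def /= expr0n addr0 sqrtr_sqr -ltcR re.
Qed.

End Isometries.

(** * Gluing isometries with mutually orthogonal ranges *)

Section OrthogonalSum.
Variables (R : realType) (I : countType) (E H : hilbertType R).
Variable V : I -> {linear E -> H}.
Implicit Types F G : ell2 I E.

(** Enumerated as in [enum_family], so that the partial sums match those of the scalar series of
    squared norms index by index. *)
Definition ell2_terms F (k : nat) : H := oapp (fun i => V i (F i)) 0 (pickle_inv k).

Hypothesis V_ortho : forall i j x y,
  inner (V i x) (V j y) = if i == j then inner x y else 0.

(** Pythagoras. It transfers the Cauchy property from the scalar series to the vector series, and in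
    the limit it gives the norm of the sum. *)
Lemma orthogonal_terms_sqr_norm F (s : seq nat) : uniq s ->
  `|\sum_(k <- s) ell2_terms F k| ^+ 2 =
  (\sum_(k <- s) enum_family (fun i => sqn (F i)) k)%:C.
Proof.
move=> us; rewrite sqr_norm_sum_ortho //; last first.
  move=> j k; rewrite /ell2_terms; have := @pickle_invK I j; have := @pickle_invK I k.
  case: (pickle_inv j) => [i|] /=; last by rewrite linear0l.
  case: (pickle_inv k) => [i'|] /=; last by rewrite linear0r.
  move=> <- <- /negPf ij; rewrite V_ortho; case: eqP => // ii.
  by rewrite ii eqxx in ij.
rewrite rmorph_sum; apply: eq_bigr => k _; rewrite /ell2_terms /enum_family /=.
case: (pickle_inv k) => [i|] /=; last by rewrite normr0 expr0n.
by rewrite -inner_norm V_ortho eqxx -sqnE.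
Qed.

Lemma orthogonal_sum_is_cvg F : cvgn (series (ell2_terms F)).
Proof.
apply: cauchy_cvg; apply/cauchy_seriesP => e e0.
have re : (complex.Re e)%:C = e by rewrite ReK // ltW.
have r0 : 0 < complex.Re e by rewrite -ltcR re.
have /cvg_cauchy/cauchy_seriesP/(_ (complex.Re e ^+ 2)) : summable_family (fun i => sqn (F i)).
  exact: ell2P.
rewrite exprn_gt0 // => /(_ isT); apply: filterS => -[m k] /=.
move=> /(le_lt_trans (ler_norm _)) h.
rewrite -(@ltr_pXn2r _ 2) ?nnegrE ?(ltW e0) //.
by rewrite orthogonal_terms_sqr_norm ?iota_uniq // -re -rmorphXn ltcR.
Qed.

Definition orthogonal_sum F : H := limn (series (ell2_terms F)).

Lemma orthogonal_sum_cvg F : series (ell2_terms F) @ \oo --> orthogonal_sum F.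
Proof. exact: orthogonal_sum_is_cvg. Qed.

Lemma orthogonal_sum_linear : linear orthogonal_sum.
Proof.
move=> c F G; apply: cvg_lim => //.
have -> : series (ell2_terms (c *: F + G)) =
    c *: series (ell2_terms F) + series (ell2_terms G).
  apply/funext => n; rewrite !fctE /series /= scaler_sumr -big_split /=.
  apply: eq_bigr => k _; rewrite /ell2_terms; case: pickle_inv => [i|] /=.
    exact: (linearP (V i)).

  by rewrite scaler0 addr0.
by apply: cvgD; [apply: cvgZr|]; exact: orthogonal_sum_cvg.
Qed.

Lemma orthogonal_sum_norm F : `|orthogonal_sum F| = `|F|.
Proof.
apply: eqr_sqr_norm; rewrite ell2_sqr_norm.
have c1 : (fun n => `|series (ell2_terms F) n| ^+ 2) @ \oo --> `|orthogonal_sum F| ^+ 2.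
  have h := cvg_norm (@orthogonal_sum_cvg F).
  exact: (cvgM (h _) (h _)).
have sF : series (enum_family (fun i => sqn (F i))) @ \oo -->
    family_sum (fun i => sqn (F i)) by exact: ell2P.
have c2 := cvg_real_complex sF.
apply: cvg_unique c1 _ => //.
apply: cvg_trans c2; apply: near_eq_cvg; apply: nearW => n.
by rewrite /series orthogonal_terms_sqr_norm ?iota_uniq.
Qed.

Lemma orthogonal_sum_single i x : orthogonal_sum (ell2_single i x) = V i x.
Proof.
(* Only the term at index [pickle i] can be nonzero, so the partial sums are constant from
   [(pickle i).+1] on. *)
apply: cvg_lim => //; apply: cvg_near_cst; exists (pickle i).+1 => // n /= lt_in.
rewrite /series /= (bigD1_seq (pickle i)) ?iota_uniq ?mem_index_iota //=.
rewrite {1}/ell2_terms pickleK_inv /= /ell2_single_fun eqxx big1 ?addr0 // => k.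
rewrite /ell2_terms; have := @pickle_invK I k; case: pickle_inv => //= j <- ji.
by rewrite /ell2_single_fun ifN ?linear0 //; apply: contraNneq ji => ->.
Qed.

(** Used for [ell2_single] itself, where the third clause yields the coordinate expansion, and for
    [odometer_ket], where it builds the odometer map. *)
Lemma orthogonal_extension : exists W : {linear ell2 I E -> H},
  [/\ isometric_operator W,
      forall i x, W (ell2_single i x) = V i x
    & forall F, series (ell2_terms F) @ \oo --> W F].
Proof.
pose W : {linear ell2 I E -> H} :=
  HB.pack orthogonal_sum (GRing.isLinear.Build _ _ _ _ _ orthogonal_sum_linear).
exists W.
split; [exact: orthogonal_sum_norm|exact: orthogonal_sum_single|exact: orthogonal_sum_cvg].
Qed.

End OrthogonalSum.

(** * Coordinate expansions and supports *)

Lemma linear_span_sum (K : numFieldType) (V : normedModType K) (J : eqType)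
    (A : set V) (s : seq J) (x : J -> V) :
  (forall j, j \in s -> A (x j)) -> linear_span A (\sum_(j <- s) x j).
Proof.
move=> Ax; exists (size s), (fun=> 1), (fun k => x (tnth (in_tuple s) k)).
split; first by move=> k; apply/Ax/mem_tnth.
by rewrite big_tnth; apply: eq_bigr => k _; rewrite scale1r.
Qed.

Section Support.
Variables (R : realType) (I : countType) (E : hilbertType R).
Implicit Types F : ell2 I E.

(** The isometry glued from the coordinate embeddings fixes their images, which span a dense
    subspace. It is therefore the identity, and its defining series is the expansion of [F]. *)
Lemma series_single_cvg F : series (ell2_terms (@ell2_single R I E) F) @ \oo --> F.
Proof.
have [W [Wiso WE Wcvg]] := orthogonal_extension (@inner_single R I E).
have WF : W F = F.
  have cW : continuous W by exact/bounded_linear_continuous/isometric_bounded.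
  have cid : continuous (idfun : {linear ell2 I E -> ell2 I E}) by move=> x; exact: cvg_id.
  apply: (eq_on_closed_span cW cid); last exact: closed_span_single.
  by move=> _ [i [x ->]]; rewrite WE.
by rewrite -[X in _ --> X]WF; exact: Wcvg.
Qed.

(** The partial sums of the coordinate expansion converge to [F]; once their zero terms are
    discarded, all remaining indices lie in [A]. *)
Lemma closed_span_support F (A : set I) : (forall i, F i != 0 -> A i) ->
  closure (linear_span [set x | exists i eta, A i /\ x = ell2_single i eta]) F.
Proof.
move=> FA; apply: (@closed_cvg _ _ _ _ _ (closure _)); last exact: (@series_single_cvg F).
- exact: eventually_filter.
- exact: closed_closure.
apply: nearW => n; apply: subset_closure; rewrite /series /=.
set t := ell2_terms _ _; rewrite (bigID (fun k => t k == 0)) /= big1 ?add0r; last first.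
  by move=> k /eqP.
rewrite -big_filter; apply: linear_span_sum => k; rewrite mem_filter => /andP[+ _].
rewrite /t /ell2_terms; case: pickle_inv => [i|] /=; last by rewrite eqxx.
move=> Fi; exists i, (F i); split=> //; apply: FA.
by apply: contraNneq Fi => ->; rewrite linear0.
Qed.

Lemma eval_closed_span (A : set (ell2 I E)) i : (forall F, A F -> F i = 0) ->
  forall F, closure (linear_span A) F -> F i = 0.
Proof.
move=> Ai F AF.
have lin_ev : linear (fun G : ell2 I E => G i) by [].
pose ev : {linear ell2 I E -> E} :=
  HB.pack (fun G : ell2 I E => G i) (GRing.isLinear.Build _ _ _ _ _ lin_ev).
have cev : continuous ev.
  apply/bounded_linear_continuous/(@linear_le_norm_bounded _ _ _ ev 1) => // G.
  by rewrite mul1r; exact: ell2_le_norm.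
have c0 : continuous (\0 : {linear ell2 I E -> E}) by exact: cst_continuous.
exact: (eq_on_closed_span cev c0 Ai AF).
Qed.

End Support.

(** * Reindexed sums and isometry of the creation operators *)

Lemma family_sum_reindex (R : realType) (I J : countType) (h : I -> J)
    (g : J -> option I) (u : J -> R) :
  pcancel h g -> ocancel g h -> (forall j, 0 <= u j) ->
  (forall j, g j = None -> u j = 0) -> summable_family u ->
  family_sum (u \o h) = family_sum u.
Proof.
move=> hg gh u0 ug su.
have uh0 i : 0 <= (u \o h) i by exact: u0.
(* The two families are enumerated in unrelated orders. Since the terms are nonnegative, it suffices
   to bound the finite sums of each by the sum of the other. *)
have le_u (s : seq I) : uniq s -> \sum_(i <- s) (u \o h) i <= family_sum u.
  move=> us; rewrite -(big_map h predT).
  by apply: finite_sum_le_family_sum => //; rewrite map_inj_uniq //; exact: pcan_inj hg.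
apply/le_anti/andP; split; first exact: family_sum_le.
apply: family_sum_le => // s us.
have -> : \sum_(j <- s) u j = \sum_(i <- pmap g s) (u \o h) i.
  elim: s {us} => [|j s IH]; rewrite ?big_nil // big_cons /= IH.
  have := gh j; case gj: (g j) => [i|] /= => [<-|_]; first by rewrite big_cons.
  by rewrite ug ?add0r.
apply: finite_sum_le_family_sum => //; first exact: summable_family_bounded le_u.
exact: pmap_uniq us.
Qed.

Lemma creation_isometric (R : realType) (n : nat) (H : hilbertType R) (i : 'I_n) :
  isometric_operator (@creation_tuple R n H i).
Proof.
move=> F; apply: eqr_sqr_norm; rewrite !ell2_sqr_norm; congr (_ %:C).
(* [g] strips a leading [i]; on the words where it is undefined, [creation i F] vanishes. *)
pose g mu := if mu is j :: nu then if j == i then Some nu else None else None.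
rewrite -(@family_sum_reindex _ _ _ (cons i) g); last exact: ell2P.
- by congr family_sum; apply/funext => nu /=; rewrite eqxx.
- by move=> nu; rewrite /= eqxx.
- by case=> [|j nu] //=; case: eqP => //= ->.
- by move=> mu; exact: sqn_ge0.
- by case=> [|j nu] /=; [rewrite /sqn linear0l|case: eqP => //; rewrite /sqn linear0l].
Qed.

(** * The adding machine on words *)

Section OdometerWords.
Variable n : nat.
Implicit Types mu nu lam : seq 'I_n.+1.

(* Addition of one with carry, the first letter being the least significant
   digit; [None] when the carry leaves the word. *)
Fixpoint succ_word mu : option (seq 'I_n.+1) :=
  if mu is i :: nu then
    if i == ord_max then omap (cons ord0) (succ_word nu) else Some (inord i.+1 :: nu)
  else None.

Lemma succ_word_None mu : succ_word mu = None <-> mu = nseq (size mu) ord_max.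
Proof.
elim: mu => [|i mu IH] //=; case: eqP => [->|ine]; last first.
  by split=> // -[].
split; last by case=> /IH ->.
by case: succ_word IH => // IH _; rewrite -(proj1 IH).
Qed.

Lemma inord_succ (i i' : 'I_n.+1) : i' = i.+1 :> nat -> inord i.+1 = i'.
Proof. by move=> ii; rewrite -ii inord_val. Qed.

Lemma succ_word_carry j (i i' : 'I_n.+1) nu : i' = i.+1 :> nat ->
  succ_word (nseq j ord_max ++ i :: nu) = Some (nseq j ord0 ++ i' :: nu).
Proof.
move=> ii; elim: j => [|j IH] /=; last by rewrite eqxx IH.
rewrite (inord_succ ii) ifN //; apply/eqP => im.
by have := ltn_ord i'; rewrite ii im ltnn.
Qed.

Lemma val_inord_succ (i : 'I_n.+1) : i != ord_max -> (inord i.+1 : 'I_n.+1) = i.+1 :> nat.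
Proof.
move=> ine; rewrite inordK // ltnS ltn_neqAle -ltnS ltn_ord andbT.
by apply: contraNneq ine => h; apply/eqP/val_inj.
Qed.

(** The first letter of a successor is [ord0] exactly after a carry, so it reveals which rule was
    applied. *)
Lemma succ_word_inj mu nu lam :
  succ_word mu = Some lam -> succ_word nu = Some lam -> mu = nu.
Proof.
elim: mu nu lam => [|i mu IH] [|j nu] lam //=.
have neq0 (k : 'I_n.+1) : k != ord_max -> ord0 != inord k.+1 :> 'I_n.+1.
  by move=> /val_inord_succ h; rewrite -val_eqE /= h.
have [->|ine] := eqVneq i ord_max; have [->|jne] := eqVneq j ord_max.
- case E1: succ_word => [l|] //= [<-]; case E2: succ_word => [l'|] //= [] ll.
  by rewrite (IH nu l) // E2 ll.
- case: succ_word => [l|] //= [<-] [/eqP]; rewrite eq_sym => /eqP h.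
  by have := neq0 _ jne; rewrite h eqxx.
- move=> [<-]; case: succ_word => [l|] //= [] h.
  by have := neq0 _ ine; rewrite h eqxx.
- move=> [<-] [] h ->; congr (_ :: _); apply/val_inj/succn_inj.
  by rewrite -(val_inord_succ ine) -(val_inord_succ jne) h.
Qed.

(** The carry stops at a letter that is incremented, and this letter becomes different from
    [ord0]. *)
Lemma succ_word_neq_nseq mu lam m : succ_word mu = Some lam -> lam <> nseq m ord0.
Proof.
elim: mu lam m => [|i mu IH] //= lam m; case: eqP => [_|/eqP/val_inord_succ ine].
  case: succ_word IH => //= l IH [<-]; case: m => [|m] //= [].
  exact: IH.
by case=> <-; case: m => [|m] //= [] h; have := congr1 val h; rewrite /= ine.
Qed.

(** By [succ_word_carry], the words of the second form are successors; hence every word other than a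
    power of [ord0] is one. *)
Lemma word_nseq0_or_carry lam :
  (exists m, lam = nseq m ord0) \/
  exists j (i i' : 'I_n.+1) nu, i' = i.+1 :> nat /\ lam = nseq j ord0 ++ i' :: nu.
Proof.
elim: lam => [|k lam IH]; first by left; exists 0%N.
have [->|k0] := eqVneq k ord0.
  case: IH => [[m ->]|[j [i [i' [nu [ii ->]]]]]]; first by left; exists m.+1.
  by right; exists j.+1, i, i', nu.
have kp : (0 < k)%N by rewrite lt0n; apply: contra k0.
right; exists 0%N, (inord k.-1), k, lam; split=> //.
by rewrite inordK prednK // ltnW.
Qed.

End OdometerWords.


(** * The prescribed images of the elementary tensors *)

Section Odometer.
Variables (R : realType) (n : nat) (E : hilbertType R).
Variable L : {linear E -> fock_tensor n.+1 E}.
Local Notation K := (fock_tensor n.+1 E).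

Lemma shift1_linear m : linear (@shift1 R n E m).
Proof. by elim: m => [|m IH] c F G //=; rewrite IH linearP. Qed.

Lemma inner_creation i (F G : K) : inner (creation i F) (creation i G) = inner F G.
Proof. exact: (isometric_inner (@creation_isometric R n.+1 E i)). Qed.

Lemma inner_shift1 m (F G : K) : inner (shift1 m F) (shift1 m G) = inner F G.
Proof. by elim: m => //= m IH; rewrite inner_creation. Qed.

Lemma shift1D m p (F : K) : shift1 (m + p) F = shift1 m (shift1 p F).
Proof. exact: iterD. Qed.

(** A shift only prepends [ord0], which keeps the support inside the powers of [ord0]. *)
Lemma shift1_support m (F : K) :
  (forall lam, (forall p, lam <> nseq p ord0) -> F lam = 0) ->
  forall lam, (forall p, lam <> nseq p ord0) -> shift1 m F lam = 0.
Proof.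
move=> F0; elim: m => [|m IH] // [|k lam] hlam //=.
case: eqP => // k0; apply: IH => p lamp.
by apply: (hlam p.+1); rewrite k0 lamp.
Qed.

(** The value that the defining equations force on [ket mu eta]. When [succ_word] fails, [mu] is a
    power of [ord_max], so its length is the number of shifts. *)
Definition odometer_ket (mu : seq 'I_n.+1) (eta : E) : K :=
  if succ_word mu is Some lam then ket lam eta else shift1 (size mu) (L eta).

Lemma odometer_ket_linear mu : linear (odometer_ket mu).
Proof.
move=> c x y; rewrite /odometer_ket; case: succ_word => [lam|].
  exact: linearP (@ell2_single R _ E lam) c x y.
by rewrite linearP shift1_linear.
Qed.

HB.instance Definition _ mu :=
  GRing.isLinear.Build R[i] E K *:%R (odometer_ket mu) (odometer_ket_linear mu).

Lemma odometer_ket_nseq m eta : odometer_ket (nseq m ord_max) eta = shift1 m (L eta).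
Proof.
have /succ_word_None : nseq m (@ord_max n) = nseq (size (nseq m (@ord_max n))) ord_max.
  by rewrite size_nseq.
by rewrite /odometer_ket => ->; rewrite size_nseq.
Qed.

Lemma odometer_ket_carry j (i i' : 'I_n.+1) nu eta : i' = i.+1 :> nat ->
  odometer_ket (nseq j ord_max ++ i :: nu) eta = ket (nseq j ord0 ++ i' :: nu) eta.
Proof. by move=> ii; rewrite /odometer_ket (succ_word_carry _ _ ii). Qed.

(** This is the relation [W T_n = T_1 W] on elementary tensors. *)
Lemma odometer_ket_max mu eta :
  odometer_ket (ord_max :: mu) eta = creation ord0 (odometer_ket mu eta).
Proof.
rewrite /odometer_ket /= eqxx; case: succ_word => [lam|] //=.
by rewrite creation_ket.
Qed.

Lemma symbol_space_support F : symbol_space L F ->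
  forall lam, (forall p, lam <> nseq p ord0) -> F lam = 0.
Proof.
case=> + _ lam hlam; apply: eval_closed_span => _ [m [eta ->]].
by rewrite /= /ell2_single_fun ifN //; apply/eqP.
Qed.

Lemma symbol_space_ortho F p eta : symbol_space L F -> (0 < p)%N ->
  inner F (shift1 p (L eta)) = 0.
Proof.
move=> [_ Fo] p0; apply: Fo; apply: subset_closure.
exists 1%N, (fun=> 1), (fun=> shift1 p (L eta)).
by split=> [_|]; [exists p, eta|rewrite big_ord1 scale1r].
Qed.

(** * Sufficiency of the two conditions *)

Section Sufficiency.
Hypotheses (L_iso : isometric_operator L) (L_symbol : range L `<=` symbol_space L).

Let L_in eta : symbol_space L (L eta).
Proof. by apply: L_symbol; exists eta. Qed.

(** Once the common shifts are cancelled, the isometry of [L] settles [m = p], and otherwise the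
    orthogonality in [symbol_space] applies to the remaining positive shift. *)
Lemma inner_shift1_L m p eta zeta :
  inner (shift1 m (L eta)) (shift1 p (L zeta)) = if m == p then inner eta zeta else 0.
Proof.
wlog mp : m p eta zeta / (m <= p)%N.
  move=> h; case: (leqP m p) => [|/ltnW] mp; first exact: h.
  have := h _ _ zeta eta mp; rewrite eq_sym; case: eqP => _ hh.
    by rewrite hermC /= hh [RHS]hermC.
  exact: innerC0.
rewrite -(subnKC mp) shift1D inner_shift1; case: (posnP (p - m)) => [->|pm].
  by rewrite addn0 eqxx; exact: (isometric_inner L_iso).
rewrite symbol_space_ortho // ifN //.
by rewrite -[X in X == _]addn0 eqn_add2l eq_sym -lt0n.
Qed.

Lemma inner_shift1_L_ket m lam eta zeta : (forall p, lam <> nseq p ord0) ->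
  inner (shift1 m (L eta)) (ket lam zeta) = 0.
Proof.
move=> hlam; rewrite inner_singler shift1_support ?linear0l //.
exact: symbol_space_support.
Qed.

(** Two successors are separated by injectivity of [succ_word], a successor and an overflow by their
    disjoint supports, and two overflows by their word lengths. *)
Lemma odometer_ket_ortho mu nu eta zeta :
  inner (odometer_ket mu eta) (odometer_ket nu zeta) =
  if mu == nu then inner eta zeta else 0.
Proof.
rewrite /odometer_ket; case Emu: (succ_word mu) => [lam|]; case Enu: (succ_word nu) => [lam'|].
- rewrite inner_ket; congr (if _ then _ else _); apply/eqP/eqP => [ll|mn].
    by rewrite -ll in Enu; exact: succ_word_inj Emu Enu.
  by move: Emu; rewrite mn Enu => -[].
- rewrite ifN; last by apply: contraPneq Emu => ->; rewrite Enu.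
  apply: innerC0; apply: inner_shift1_L_ket => p; exact: succ_word_neq_nseq Emu.
- rewrite ifN; last by apply: contraPneq Emu => ->; rewrite Enu.
  apply: inner_shift1_L_ket => p; exact: succ_word_neq_nseq Enu.
- rewrite inner_shift1_L; congr (if _ then _ else _).
  apply/eqP/eqP => [smn|-> //].
  by rewrite (proj1 (succ_word_None mu) Emu) smn -(proj1 (succ_word_None nu) Enu).
Qed.

(** The semigroup relations hold on elementary tensors and extend by density, because both sides are
    isometries and hence continuous. *)
Lemma odometer_map_exists : exists W : {linear K -> K},
  is_odometer_map L W /\ isometric_fock_representation W.
Proof.
have [W [Wiso WE _]] := orthogonal_extension odometer_ket_ortho.
have Wb := isometric_bounded Wiso.
have Sb i := isometric_bounded (@creation_isometric R n.+1 E i).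
have continuous_comp_isometric (f g : {linear K -> K}) :
    isometric_operator f -> isometric_operator g -> continuous (f \o g).
  move=> fi gi; apply/bounded_linear_continuous/isometric_bounded => x.
  by rewrite /= fi; exact: gi.
exists W; split; [split=> //|split=> //; split=> //].
- by move=> eta; rewrite WE; exact: (odometer_ket_nseq 0).
- by move=> m eta _; rewrite WE; exact: odometer_ket_nseq.
- by move=> j i i' nu eta ii; rewrite WE; exact: odometer_ket_carry.
- move=> i i' x ii.
  apply: (@eq_on_closed_span _ _ _ (W \o creation_tuple E i) (creation_tuple E i')
    [set x | exists mu eta, x = ket mu eta]).
  + by apply: continuous_comp_isometric => //; exact: creation_isometric.
  + exact/bounded_linear_continuous/Sb.
  + move=> _ [mu [eta ->]] /=; rewrite !creation_ket WE.
    exact: (odometer_ket_carry 0).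
  + exact: closed_span_ket.
- move=> x.
  apply: (@eq_on_closed_span _ _ _ (W \o creation_tuple E ord_max)
    (creation_tuple E ord0 \o W) [set x | exists mu eta, x = ket mu eta]).
  + by apply: continuous_comp_isometric => //; exact: creation_isometric.
  + by apply: continuous_comp_isometric => //; exact: creation_isometric.
  + move=> _ [mu [eta ->]] /=; rewrite !creation_ket !WE.
    exact: odometer_ket_max.
  + exact: closed_span_ket.
Qed.

End Sufficiency.

(** * Necessity of the two conditions *)

Section Necessity.
Variable W : {linear K -> K}.
Hypotheses (W_map : is_odometer_map L W) (W_iso : isometric_operator W).

Lemma odometer_map_nseq m eta : W (ket (nseq m ord_max) eta) = shift1 m (L eta).
Proof. by case: W_map => _ W0 Wm _; case: m => [|m]; [exact: W0|exact: Wm]. Qed.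

Lemma symbol_isometric : isometric_operator L.
Proof.
move=> eta; rewrite -[L eta](odometer_map_nseq 0) W_iso; apply: eqr_sqr_norm.
by rewrite -!inner_norm; exact: inner_ket.
Qed.

(** [L eta] is the image of the vacuum tensor [ket [::] eta], and [W] preserves orthogonality. *)
Lemma symbol_ortho_image mu eta zeta : mu != [::] -> inner (L eta) (W (ket mu zeta)) = 0.
Proof.
move=> mu0; rewrite -[L eta](odometer_map_nseq 0) (isometric_inner W_iso) inner_ket.
by rewrite ifN // eq_sym.
Qed.

Lemma range_symbol_space : range L `<=` symbol_space L.
Proof.
move=> _ [eta _ <-]; split.
  (* If [lam] has a letter other than [ord0], every tensor over [lam] is the image under [W] of one
     over a nonempty word, hence orthogonal to [L eta]. Taking the coordinate [L eta lam] as its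
     second factor shows that this coordinate is zero. *)
  have supp lam : L eta lam != 0 -> exists m, lam = nseq m ord0.
    case: (word_nseq0_or_carry lam) => // -[j [i [i' [nu [ii ->]]]]] /negP [].
    rewrite -(dnorm_eq0 inner) -inner_singler.
    case: W_map => _ _ _ Wc; rewrite -[ell2_single _ _]/(ket _ _) -(Wc _ _ _ _ _ ii).
    by rewrite symbol_ortho_image //; case: j.
  apply: closure_subset (closed_span_support supp) => _ [m [c [v [Av ->]]]].
  exists m, c, v; split=> // k; have [_ [x [[p ->] ->]]] := Av k.
  by exists p, x.
(* For [p >= 1], the vector [shift1 p (L zeta)] is the image of a tensor over the nonempty word
   [nseq p ord_max]. *)
move=> F AF; apply: innerC0; move: F AF; apply: closed_span_ortho => _ [p [zeta [p0 ->]]].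
apply: innerC0; rewrite -odometer_map_nseq; apply: symbol_ortho_image.
by case: p p0.
Qed.

End Necessity.

End Odometer.

Theorem theorem1p4 (R : realType) (n : nat)
    (E : hilbertType R) (E_separable : separable_space E)
    (L : {linear E -> fock_tensor n.+1 E}) (L_bounded : bounded_operator L) :
  (exists W : {linear fock_tensor n.+1 E -> fock_tensor n.+1 E},
      is_odometer_map L W /\ isometric_fock_representation W)
  <->
  (isometric_operator L /\ range L `<=` symbol_space L).
Proof.
split=> [[W [W_map [_ W_iso]]]|[L_iso L_symbol]]; last exact: odometer_map_exists.
by split; [exact: symbol_isometric W_map W_iso|exact: range_symbol_space W_map W_iso].
Qed.
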